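(* Let $X$ be a complete metric space and $f:X\to\mathbb{R}\cup\{+\infty\}$ a lower semi-continuous function such that $$\forall (u,\xi)\in\operatorname{epi}(f):\quad f(u)<\xi\ \Longrightarrow\ |d\mathcal{G}_f|(u,\xi)=1.$$ Let $\mathbb{D}$ and $\mathbb{S}$ denote the closed unit ball and the unit sphere in $\mathbb{R}^N$ respectively, let $\Gamma_0\subset C(\mathbb{S},X)$, and define $$\Gamma=\big\{\gamma\in C(\mathbb{D},X):\ \gamma|_{\mathbb{S}}\in\Gamma_0\big\}.$$ Assume that $$+\infty>c=\inf_{\gamma\in\Gamma}\sup_{\tau\in\mathbb{D}}f(\gamma(\tau))>\sup_{\gamma_0\in\Gamma_0}\sup_{\tau\in\mathbb{S}}f(\gamma_0(\tau))=a.$$ Then, for every $\varepsilon\in(0,(c-a)/2)$, every $\delta>0$ and every $\gamma\in\Gamma$ such that $$\sup_{\tau\in\mathbb{D}}f(\gamma(\tau))\leq c+\varepsilon,$$ there exists $u\in X$ such that $$c-2\varepsilon\leq f(u)\leq c+2\varepsilon,\qquad \operatorname{dist}\big(u,\gamma(\mathbb{D})\cap f^{-1}([c-3\varepsilon,c+3\varepsilon])\big)\leq 3\delta,\qquad |df|(u)\leq 3\varepsilon/\delta.$$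
   Context: Weak slope. For a metric space $(Y,d)$, a continuous function $\phi:Y\to\mathbb{R}$ and $y\in Y$, the weak slope $|d\phi|(y)\in[0,+\infty]$ is the supremum of the $\sigma\in[0,\infty)$ for which there exist $\delta>0$ and a continuous map $\mathcal{H}:B(y,\delta)\times[0,\delta]\to Y$ ($B(y,\delta)$ the open ball) such that $d(\mathcal{H}(v,t),v)\leq t$ and $\phi(\mathcal{H}(v,t))\leq\phi(v)-\sigma t$ for all $v\in B(y,\delta)$, $t\in[0,\delta]$. For a function $f$ on a metric space $(X,d)$, $\operatorname{epi}(f)=\{(u,\xi)\in X\times\mathbb{R}: f(u)\leq\xi\}$ is endowed with the metric $d((u,\xi),(v,\mu))=(d(u,v)^2+(\xi-\mu)^2)^{1/2}$, and $\mathcal{G}_f:\operatorname{epi}(f)\to\mathbb{R}$ is $\mathcal{G}_f(u,\xi)=\xi$ (Lipschitz of constant $1$, so its weak slope is at most $1$). For $f$ lower semi-continuous and $u$ with $f(u)\in\mathbb{R}$, the weak slope of $f$ is $$|df|(u)=\frac{|d\mathcal{G}_f|(u,f(u))}{\sqrt{1-|d\mathcal{G}_f|(u,f(u))^2}}\ \text{ if }|d\mathcal{G}_f|(u,f(u))<1,\qquad |df|(u)=+\infty\ \text{ if }|d\mathcal{G}_f|(u,f(u))=1.$$ For $A\subset X$, $\operatorname{dist}(u,A)=\inf_{v\in A}d(u,v)$. *)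

(* Defs.v *)
From HB Require Import structures.
From mathcomp Require Import all_boot all_order all_algebra.
From mathcomp Require Import all_classical all_reals all_analysis.
From mathcomp Require Import ring lra.

Set Implicit Arguments.
Unset Strict Implicit.
Unset Printing Implicit Defensive.

Import Order.TTheory GRing.Theory Num.Theory.
Import numFieldNormedType.Exports.

Local Open Scope classical_set_scope.
Local Open Scope ring_scope.

(* [Complete] includes a distinguished point: these are the nonempty complete
   metric spaces. *)
#[short(type="completeMetricType")]
HB.structure Definition CompleteMetric (R : numDomainType) :=
  {T of Metric R T & Complete T}.

(* The deformation is a total function of which only the restriction to
   B(y, delta) x [0, delta] matters. *)
Definition weak_slope (R : realType) (Y : metricType R) (phi : Y -> R) (y : Y)
    : \bar R :=
  ereal_sup [set sigma%:E | sigma in [set sigma : R | 0 <= sigma /\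
    exists2 delta : R, 0 < delta &
    exists H : Y * R -> Y,
      {within ball y delta `*` `[0, delta], continuous H} /\
      forall v t, ball y delta v -> 0 <= t <= delta ->
        mdist (H (v, t)) v <= t /\ phi (H (v, t)) <= phi v - sigma * t]].

(* A record of its own, so that it carries the Euclidean product distance below
   and not the sup distance that X * R has in the library. *)
Record epi (R : realType) (X : metricType R) (f : X -> \bar R) := Epi {
  epi_pt : X * R;
  epi_ptP : (f epi_pt.1 <= epi_pt.2%:E)%E }.

HB.instance Definition _ (R : realType) (X : metricType R) (f : X -> \bar R) :=
  [isSub for @epi_pt R X f].
HB.instance Definition _ (R : realType) (X : metricType R) (f : X -> \bar R) :=
  [Choice of epi f by <:].

Section epi_metric.
Context (R : realType) (X : metricType R) (f : X -> \bar R).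
Implicit Types p q r : epi f.

Definition epi_dist p q : R :=
  Num.sqrt (mdist (epi_pt p).1 (epi_pt q).1 ^+ 2
            + ((epi_pt p).2 - (epi_pt q).2) ^+ 2).

Lemma epi_distxx p : epi_dist p p = 0.
Proof. by rewrite /epi_dist mdistxx subrr expr0n addr0 sqrtr0. Qed.

Lemma epi_dist_positivity p q : epi_dist p q = 0 -> p = q.
Proof.
move=> /eqP; rewrite /epi_dist sqrtr_eq0 => h.
have /eqP : mdist (epi_pt p).1 (epi_pt q).1 ^+ 2
            + ((epi_pt p).2 - (epi_pt q).2) ^+ 2 = 0.
  by apply/le_anti; rewrite h addr_ge0 // sqr_ge0.
rewrite paddr_eq0 ?sqr_ge0 // !sqrf_eq0 subr_eq0 => /andP[/eqP e1 /eqP e2].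
apply: val_inj => /=; move: (mdist_positivity _ _ e1) e2.
by case: (epi_pt p) => ? ?; case: (epi_pt q) => ? ? /= -> ->.
Qed.

Lemma epi_dist_sym p q : epi_dist p q = epi_dist q p.
Proof. by rewrite /epi_dist metric_sym -(sqrrN ((epi_pt p).2 - _)) opprB. Qed.

Lemma epi_dist_triangle q p r : epi_dist p r <= epi_dist p q + epi_dist q r.
Proof.
rewrite /epi_dist; set P := epi_pt p; set Q := epi_pt q; set S := epi_pt r.
have -> : P.2 - S.2 = (P.2 - Q.2) + (Q.2 - S.2) by rewrite addrA subrK.
move: (metric_triangle P.1 Q.1 S.1) (mdist_ge0 P.1 S.1) (mdist_ge0 P.1 Q.1).
move: (mdist_ge0 Q.1 S.1) (P.2 - Q.2) (Q.2 - S.2).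
set a := mdist P.1 Q.1; set b := mdist Q.1 S.1; set c := mdist P.1 S.1.
move=> b0 x y tri c0 a0.
have n0 (s t : R) : 0 <= s ^+ 2 + t ^+ 2 by rewrite addr_ge0 // sqr_ge0.
rewrite -ler_sqr ?nnegrE ?addr_ge0 ?sqrtr_ge0 // [leRHS]sqrrD !sqr_sqrtr //.
rewrite -sqrtrM //.
have cs : a * b + x * y
    <= Num.sqrt ((a ^+ 2 + x ^+ 2) * (b ^+ 2 + y ^+ 2)).
  apply: le_trans (ler_norm _) _; rewrite -sqrtr_sqr ler_sqrt ?mulr_ge0 //.
  by have := sqr_ge0 (a * y - x * b); nra.
have : c ^+ 2 <= (a + b) ^+ 2 by rewrite ler_sqr ?nnegrE ?addr_ge0.
rewrite mulr2n; nra.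
Qed.

HB.instance Definition _ := isMetric.Build R (epi f)
  epi_distxx epi_dist_positivity epi_dist_sym epi_dist_triangle.

Definition epi_height (p : epi f) : R := (epi_pt p).2.

Lemma epi_graph_subproof u : f u \is a fin_num ->
  (f (u, fine (f u)).1 <= (u, fine (f u)).2%:E)%E.
Proof. by move=> /fineK /= ->. Qed.

Definition epi_graph u (fu : f u \is a fin_num) : epi f :=
  Epi (epi_graph_subproof fu).

(* The weak slope |df|(u), defined at the points where f is finite. *)
Definition lsc_weak_slope u (fu : f u \is a fin_num) : \bar R :=
  let s := weak_slope epi_height (epi_graph fu) in
  if (s < 1)%E then (fine s / Num.sqrt (1 - fine s ^+ 2))%:E else +oo%E.

End epi_metric.

Section euclidean_ball.
Context (R : realType) (N : nat).

(* The library norm on row vectors is the sup norm; the topology is the same. *)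
Definition enorm (x : 'rV[R]_N) : R := Num.sqrt (\sum_i x 0 i ^+ 2).

Definition unit_disk : set 'rV[R]_N := [set x | enorm x <= 1].
Definition unit_sphere : set 'rV[R]_N := [set x | enorm x = 1].

(* Elements of C(A, X) are represented by total functions on R^N, of which only
   the restriction to A matters. *)
Definition disk_extensions (X : metricType R) (Gamma0 : set ('rV[R]_N -> X))
    : set ('rV[R]_N -> X) :=
  [set gamma | {within unit_disk, continuous gamma} /\
     exists2 gamma0, Gamma0 gamma0 &
       forall tau, unit_sphere tau -> gamma tau = gamma0 tau].

End euclidean_ball.
Arguments unit_disk : clear implicits.
Arguments unit_sphere : clear implicits.

Definition sup_on (R : realType) (T X : Type) (f : X -> \bar R) (A : set T)
    (gamma : T -> X) : \bar R :=
  ereal_sup [set f (gamma tau) | tau in A].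

Definition dist_to (R : realType) (X : metricType R) (u : X) (A : set X)
    : \bar R :=
  ereal_inf [set (mdist u v)%:E | v in A].

(* Main.v *)
Require Import Defs.
From mathcomp Require Import all_boot all_order all_algebra.
From mathcomp Require Import all_classical all_reals all_analysis.
From mathcomp Require Import ring lra.

Import Order.TTheory GRing.Theory Num.Theory.
Import numFieldNormedType.Exports.

Local Open Scope classical_set_scope.
Local Open Scope ring_scope.

(* Proof idea. Lift the competitors to paths tau |-> (u tau, xi tau) in epi f and
   let Phi be the maximal height of such a path. Order the paths by: q is below p
   when q and p agree on the sphere, the heights decrease pointwise, and the
   displacement (in epi f and in X) is bounded by multiples of Phi p - Phi q.
   A Brezis-Browder argument gives a Phi-minimal path p below a given p0. If the
   weak slope of the height exceeded s at every highest point of p, finitely many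
   of the local deformations, run one after the other with cut-off times, would
   push p to a strictly better path below it. Hence some highest point of p has
   weak slope at most s < 1, so it lies on the graph of f.
   Since heights only decrease, p0 has height at least c over the same tau, and p0
   is chosen that high only near the part of gamma where f > c - 2 eps. Taking
   s = sg / sqrt (1 + sg^2) with sg = 3 eps / delta makes the displacement in X at
   most (Phi p0 - Phi p) / sg <= delta / 3. *)

(** * Truncation to the unit interval, used for cut-offs *)

Section clamp.
Context {R : realType}.
Implicit Types x : R.

Definition clamp x : R := Num.max 0 (Num.min 1 x).

Lemma clamp_ge0 x : 0 <= clamp x.
Proof. by rewrite /clamp le_max lexx. Qed.

Lemma clamp_le1 x : clamp x <= 1.
Proof. by rewrite /clamp ge_max ler01 ge_min lexx. Qed.

Lemma clamp1 x : 1 <= x -> clamp x = 1.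
Proof. by move=> x1; rewrite /clamp min_l// max_r. Qed.

Lemma clamp0 x : x <= 0 -> clamp x = 0.
Proof. by move=> x0; rewrite /clamp max_l// ge_min x0 orbT. Qed.

Lemma clamp_continuous : continuous clamp.
Proof.
move=> x; apply: (@continuous_max R R (fun=> 0) (fun y => Num.min 1 y)).
  exact: cvg_cst.
apply: (@continuous_min R R (fun=> 1) id); first exact: cvg_cst.
exact: cvg_id.
Qed.

End clamp.

(** * Balls and continuity in metric spaces *)

Section metric.
Context {R : realType} {Y : metricType R}.
Implicit Types (y z : Y).

Lemma ball_mdistP y (e : R) z : ball y e z <-> mdist y z < e.
Proof. by rewrite ballEmdist. Qed.

Lemma within_continuous_mdistP {T : topologicalType} (D : set T) (g : T -> Y) :
  {within D, continuous g} <-> forall x, D x -> forall e : R, 0 < e ->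
    \forall z \near x, D z -> mdist (g x) (g z) < e.
Proof.
split=> [/subspace_continuousP cg x Dx|cg].
  exact/(@metricType_numDomainType.cvgrPdist_lt R Y T (within D (nbhs x)) _ g (g x))/cg.
apply/subspace_continuousP => x Dx.
apply/(@metricType_numDomainType.cvgrPdist_lt R Y T (within D (nbhs x)) _ g (g x)).
exact: cg.
Qed.

Lemma nonexpansive_continuous {Z : metricType R} (g : Y -> Z) :
  (forall y z, mdist (g y) (g z) <= mdist y z) -> continuous g.
Proof.
move=> hg y; apply/metricType_numDomainType.cvgrPdist_lt => e e0.
near=> z; have /ball_mdistP : ball y e z by near: z; exact: nbhsx_ballx.
exact/le_lt_trans/hg.
Unshelve. all: by end_near. Qed.

Lemma nonexpansive_real_continuous (g : Y -> R) :
  (forall y z, `|g y - g z| <= mdist y z) -> continuous g.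
Proof.
move=> hg y; apply/cvgrPdist_lt => e e0.
near=> z; have /ball_mdistP : ball y e z by near: z; exact: nbhsx_ballx.
exact/le_lt_trans/hg.
Unshelve. all: by end_near. Qed.

Lemma mdist_continuous y : continuous (mdist y : Y -> R).
Proof.
apply: nonexpansive_real_continuous => z w.
have := metric_triangle y z w; have := metric_triangle y w z.
rewrite (metric_sym w z) => h1 h2; rewrite ler_norml; lra.
Qed.

Lemma nbhs_mdist_lt y (e : R) z : mdist y z < e -> \forall w \near z, mdist y w < e.
Proof.
move=> yz; have := mdist_continuous y z => /cvgrPdist_lt/(_ (e - mdist y z)).
rewrite subr_gt0 => /(_ yz); apply: filterS => w; rewrite ltr_norml; lra.
Qed.

Lemma nbhs_mdist_gt y (e : R) z : e < mdist y z -> \forall w \near z, e < mdist y w.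
Proof.
move=> yz; have := mdist_continuous y z => /cvgrPdist_lt/(_ (mdist y z - e)).
rewrite subr_gt0 => /(_ yz); apply: filterS => w; rewrite ltr_norml; lra.
Qed.

End metric.

(** * Local deformations and their composition *)

Section deformation.
Context {R : realType} {Y : metricType R} (phi : Y -> R) (s : R).

(* S y is the fraction of the total time t spent moving y. *)
Definition deformation (t : R) (W V : set Y) := exists eta : Y -> Y, exists S : Y -> R,
  [/\ continuous eta, continuous S,
      forall y, [/\ 0 <= S y <= 1, mdist (eta y) y <= S y * t
                  & phi (eta y) <= phi y - s * (S y * t)],
      forall y, W y -> S y = 1 & forall y, 0 < S y -> V y].

Lemma deformation0 t V : deformation t set0 V.
Proof.
exists id, (fun=> 0); split => //=.
- by move=> y; exact: cvg_id.
- by move=> y; exact: cvg_cst.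
- by move=> y; split; rewrite ?mdistxx ?mul0r ?mulr0 ?subr0 ?lexx ?ler01.
- by move=> y; rewrite ltxx.
Qed.

(** The flow [H] given by the slope at [y0] is run after [eta], for a time cut off away from [y0].
    Only a slope [sg] strictly above [s] is extracted from the supremum, so [H] loses height at
    least at rate [s]. *)
Lemma deformation_step y0 (e : R) : (s%:E < weak_slope phi y0)%E -> 0 < e ->
  exists2 d, 0 < d & forall W V t, 0 <= t -> t <= d -> deformation t W V ->
    deformation t (W `|` ball y0 (d / 2)) (V `|` ball y0 e).
Proof.
move=> /ereal_sup_gt[_ [sg [sg0 [dl dl0 [H [cH Hp]]]] <-] + e0].
rewrite lte_fin => ssg.

(* A point within [d] of [y0], moved by [eta] by at most [t <= d], stays within [2 d <= dl] of [y0],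
   where [H] is controlled. The bound [d <= e] keeps the new support in the [e]-ball. *)
pose d := Num.min (dl / 2) e.
have d0 : 0 < d by rewrite lt_min e0 divr_gt0.
have ddl : d <= dl / 2 by rewrite ge_min lexx.
have de : d <= e by rewrite ge_min lexx orbT.
exists d => // W V t t0 td [eta [S [ceta cS etaS WS SV]]].
(* Equal to 1 up to distance [d / 2] from [y0] and to 0 from distance [3 d / 4] on. *)
pose chi y : R := clamp (3 - 4 * (mdist y0 y / d)).
have cchi : continuous chi.
  move=> y; apply: (@cvg_comp _ _ _ _ _ _ (nbhs (3 - 4 * (mdist y0 y / d))));
    last exact: clamp_continuous.
  apply: cvgB; first exact: cvg_cst.
  apply: cvgM; first exact: cvg_cst.
  apply: cvgM; [exact: mdist_continuous|exact: cvg_cst].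
(* The new flow uses only the time by which the max of the cut-offs increases, so
   the total time never exceeds t. *)
pose S' y := Num.max (S y) (chi y).
have cS' : continuous S'.
  by move=> y; apply: (@continuous_max R Y S chi); [exact: cS|exact: cchi].
have chi0 y : d * (3 / 4) <= mdist y0 y -> chi y = 0.
  move=> h; apply: clamp0; rewrite subr_le0.
  suff : 3 / 4 <= mdist y0 y / d by lra.
  by rewrite ler_pdivlMr // mulrC.
have chi1 y : mdist y0 y <= d / 2 -> chi y = 1.
  move=> h; apply: clamp1.
  suff : mdist y0 y / d <= 1 / 2 by lra.
  by rewrite ler_pdivrMr //; lra.
have SS' y : S y <= S' y <= 1.
  have [/andP[_ h] _ _] := etaS y.
  by rewrite le_max lexx ge_max h clamp_le1.
pose T y := (S' y - S y) * t.
have T0 y : 0 <= T y by have /andP[h _] := SS' y; rewrite mulr_ge0// subr_ge0.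
have Tt y : T y <= t.
  have /andP[_ h] := SS' y; have [/andP[h' _] _ _] := etaS y.
  by rewrite -[leRHS]mul1r ler_wpM2r//; lra.
have inA y : mdist y0 y < d -> (ball y0 dl `*` `[0, dl]) (eta y, T y).
  move=> yd; split => /=.
    apply/ball_mdistP; have [/andP[h1 h2] h _] := etaS y.
    have := metric_triangle y0 y (eta y); rewrite (metric_sym y).
    have : S y * t <= t by rewrite -[leRHS]mul1r ler_wpM2r.
    lra.
  by rewrite in_itv /= T0 (le_trans (Tt y))//; lra.
(* At time 0 the displacement bound forces [H] to be the identity, so both branches agree on the
   annulus between [3 d / 4] and [d] and glue continuously. *)
pose eta' y := if mdist y0 y < d then H (eta y, T y) else eta y.
have T00 y : d * (3 / 4) <= mdist y0 y -> T y = 0.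
  move=> /chi0 h; rewrite /T /S' h max_l ?subrr ?mul0r//.
  by have [/andP[]] := etaS y.
have eta'E y : d * (3 / 4) <= mdist y0 y -> eta' y = eta y.
  move=> h; rewrite /eta'; case: ifPn => // yd.
  have [/= b1 b2] := inA y yd; rewrite in_itv/= in b2.
  have [] := Hp _ _ b1 b2; rewrite T00// => h1 _.
  by apply: mdist_positivity; apply/le_anti; rewrite h1 mdist_ge0.
exists eta', S'; split => //.
- move=> y; have [yd|yd] := ltP (mdist y0 y) d.
    have nd := nbhs_mdist_lt _ _ _ yd.
    rewrite /continuous_at {2}/eta' yd.
    apply: (@cvg_trans _ (H (eta z, T z) @[z --> y])).
      apply: near_eq_cvg; apply: filterS nd => z zd.
      by rewrite /eta' zd.
    move/subspace_continuousP : cH => /(_ _ (inA y yd)) cH.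
    have cp : (eta z, T z) @[z --> y] --> (eta y, T y).
      apply: (@cvg_pair _ _ _ (nbhs y) (nbhs (eta y)) (nbhs (T y))); first exact: ceta.
      apply: cvgM; last exact: cvg_cst.
      by apply: cvgB; [exact: cS'|exact: cS].
    apply: cvg_comp cH => B; rewrite /within /= => nB.
    have := cp _ nB; rewrite /nbhs/= => {}nB.
    by apply: (filterS2 _ _ nB nd) => z /= + zd; apply; exact: inA.
  have yd2 : d * (3 / 4) < mdist y0 y by lra.
  have nd := nbhs_mdist_gt _ _ _ yd2.
  rewrite /continuous_at eta'E ?ltW//.
  apply: (@cvg_trans _ (eta z @[z --> y])); last exact: ceta.
  by apply: near_eq_cvg; apply: filterS nd => z /ltW zd; rewrite eta'E.
- move=> y; have [h1 h2 h3] := etaS y; have /andP[h4 h5] := SS' y.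
  have SpT : S' y * t = S y * t + T y by rewrite /T; ring.
  rewrite SpT /eta'; split; first by rewrite h5 andbT; lra.
    case: ifPn => yd; last by rewrite (le_trans h2)// lerDl.
    have [/= b1 b2] := inA y yd; rewrite in_itv/= in b2.
    have [h6 _] := Hp _ _ b1 b2.
    by have := metric_triangle (H (eta y, T y)) (eta y) y; lra.
  case: ifPn => yd; last first.
    by rewrite T00 ?addr0//; move: yd; rewrite -leNgt; lra.
  have [/= b1 b2] := inA y yd; rewrite in_itv/= in b2.
  have [_ h6] := Hp _ _ b1 b2.
  have : s * T y <= sg * T y by rewrite ler_wpM2r// ltW.
  lra.
- move=> y [/WS Sy|/ball_mdistP/ltW/chi1 cy]; rewrite /S' ?Sy ?cy.
    by rewrite max_l// clamp_le1.
  by rewrite max_r//; have [/andP[]] := etaS y.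
- move=> y; rewrite lt_max => /orP[/SV|cy]; first by left.
  right; apply/ball_mdistP; rewrite ltNge; apply/negP => ey.
  by move: cy; rewrite chi0 ?ltxx//; lra.
Qed.

(** Finitely many of the balls from [deformation_step] cover [C]. Starting from the trivial
    deformation, one step is made per ball, and [t0] is the least of the admissible step sizes. *)
Lemma deformation_compact (C : set Y) (e : R) : compact C -> 0 < e ->
  (forall y, C y -> (s%:E < weak_slope phi y)%E) ->
  exists W : set Y, exists2 t0, 0 < t0 &
    [/\ open W, C `<=` W & forall t, 0 <= t -> t <= t0 ->
    deformation t W [set y | exists2 x, C x & ball x e y]].
Proof.
move=> cC e0 Cs.
have : forall y, exists d, C y -> 0 < d /\ forall W V t, 0 <= t -> t <= d ->
    deformation t W V ->
    deformation t (W `|` ball y (d / 2)) (V `|` ball y e).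
  move=> y; have [Cy|nCy] := pselect (C y); last by exists 0.
  by have [d d0 hd] := deformation_step _ _ (Cs _ Cy) e0; exists d.
move=> /choice[r hr].
pose B y := ball y (r y / 2).
(* [compact_cover] needs a pointed space; near-coverings do not. *)
have [l lC Cl] : exists2 l : seq Y, (forall y, y \in l -> C y) &
    C `<=` \bigcup_(y in [set` l]) (B y)°.
  (* The filter lives on finite lists of points of [C]: a property holds eventually if it holds for
     every list that contains some fixed one. *)
  move/compact_near_coveringP : cC => /(_ (seq Y)
    (fun Q => exists2 l0 : seq Y, (forall y, y \in l0 -> C y) &
       forall l : seq Y, (forall y, y \in l -> C y) -> {subset l0 <= l} -> Q l)
    (fun l y => (\bigcup_(y in [set` l]) (B y)°) y)).
  case.
  - split; first by exists [::].
      move=> P Q [l1 l1C l1P] [l2 l2C l2Q]; exists (l1 ++ l2).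
        by move=> y; rewrite mem_cat => /orP[/l1C|/l2C].
      move=> l lC sub; split; [apply: l1P|apply: l2Q] => // y yl;
        by apply: sub; rewrite mem_cat yl ?orbT.
    by move=> P Q PQ [l0 l0C l0P]; exists l0 => // l lC sl; exact/PQ/l0P.
  - move=> y Cy; have [ry0 _] := hr _ Cy.
    exists ((B y)°, [set l : seq Y | y \in l]) => /=.
      split.
        apply: open_nbhs_nbhs; split; first exact: open_interior.
        by rewrite /interior/B; apply: nbhsx_ballx; rewrite divr_gt0.
      exists [:: y]; first by move=> z; rewrite inE => /eqP ->.
      by move=> l lC; apply; rewrite inE.
    by move=> [z l] /= [Bz yl]; exists y.
  - by move=> l lC lP; exists l => //; exact: lP.
(* Interiors make [W] open, so that later the part of a compact image outside [W] is compact. *)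
exists (\bigcup_(y in [set` l]) (B y)°).
suff [t0 t00 ht0] : exists2 t0, 0 < t0 & forall t, 0 <= t -> t <= t0 ->
    deformation t (\bigcup_(y in [set` l]) B y) [set y | exists2 x, C x & ball x e y].
  exists t0 => //; split => //.
    by apply: bigcup_open => y _; exact: open_interior.
  move=> t t1 t2; have [eta [S [h1 h2 h3 h4 h5]]] := ht0 t t1 t2.
  exists eta, S; split => // y [z zl By]; apply: h4; exists z => //.
  exact: interior_subset.
elim: l lC {Cl} => [|z l ih] lC.
  exists 1 => // t _ _; rewrite set_nil bigcup_set0; exact: deformation0.
have [|t0 t00 ht0] := ih; first by move=> y yl; apply: lC; rewrite inE yl orbT.
have Cz : C z by apply: lC; rewrite mem_head.
have [rz0 hz] := hr _ Cz.
exists (Num.min t0 (r z)); first by rewrite lt_min t00.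
move=> t t1; rewrite le_min => /andP[t2 t3].
have [eta [S [h1 h2 h3 h4 h5]]] := hz _ _ _ t1 t3 (ht0 _ t1 t2).
exists eta, S; split => //.
  move=> y [x/=]; rewrite inE => /orP[/eqP -> Bx|xl Bx]; apply: h4; [by right|].
  by left; exists x.
by move=> y /h5 [//|By]; exists z.
Qed.

End deformation.

(** * The Brezis-Browder ordering principle *)

Section order_principle.
Context {R : realType} {P : Type} (le : P -> P -> Prop) (Phi : P -> R).
Hypothesis le_refl : forall p q, le p q -> le p p.
Hypothesis le_trans : forall q p r, le p q -> le q r -> le p r.
Hypothesis le_Phi : forall p q, le p q -> Phi p <= Phi q.

(** Each [u n.+1] is chosen below [u n] with [Phi] within [1 / (n + 1)] of its infimum there. If [q]
    is below the whole chain and [r] below [q], then [Phi q <= Phi (u n.+1) <= Phi r + 1 / (n + 1)]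
    for every [n]. *)
Lemma exists_minimal_below (p0 : P) (m : R) : le p0 p0 ->
    (forall p, le p p0 -> m <= Phi p) ->
    (forall u : nat -> P, u 0%N = p0 -> (forall n, le (u n.+1) (u n)) ->
      exists q, forall n, le q (u n)) ->
  exists2 p, le p p0 & forall q, le q p -> Phi p <= Phi q.
Proof.
move=> le00 Phi_ge le_chain.
(* The condition [le np.2 p0] sits under the existential, so that one total choice function serves
   all pairs. *)
have step (np : nat * P) : exists q, le np.2 p0 ->
    le q np.2 /\ forall r, le r np.2 -> Phi q <= Phi r + np.1.+1%:R^-1.
  case: np => n p /=; have [pp0|] := pselect (le p p0); last by exists p.
  have infp : has_inf [set Phi q | q in [set q | le q p]].
    split; first by exists (Phi p), p => //; exact: le_refl pp0.
    by exists m => _ [q /= qp <-]; apply: Phi_ge; exact: le_trans pp0.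
  have n0 : 0 < n.+1%:R^-1 :> R by rewrite invr_gt0 ltr0n.
  have [_ [q /= qp <-] hq] := inf_adherent n0 infp.
  exists q => _; split => // r rp; rewrite (Order.POrderTheory.le_trans (ltW hq))//.
  by rewrite lerD2r; apply: ge_inf; [exact: infp.2|exists r].
have [g hg] := choice step.
pose fix u n := if n is k.+1 then g (k, u k) else p0.
have up0 n : le (u n) p0.
  elim: n => //= n ih; have [h _] := hg (n, u n) ih; exact: le_trans h ih.
have uS n : le (u n.+1) (u n) by have [] := hg (n, u n) (up0 n).
have [q qu] := le_chain _ erefl uS.
exists q; first exact: (le_trans _ _ _ (qu 0)).
move=> r rq; apply/ler_addgt0Pr => e e0.
have [n ne] : exists n : nat, n.+1%:R^-1 < e.
  have [n _ /(_ n (leqnn n)) /= h] := near_infty_natSinv_lt (PosNum e0).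
  by exists n.
have [_ /(_ r (le_trans _ _ _ rq (qu n)))/= h] := hg (n, u n) (up0 n).
rewrite (Order.POrderTheory.le_trans (le_Phi _ _ (qu n.+1)))//=.
by rewrite (Order.POrderTheory.le_trans h)// lerD2l ltW.
Qed.

End order_principle.

(** * Metric and completeness of the epigraph *)

Section epigraph.
Context {R : realType} {X : completeMetricType R} (f : X -> \bar R).
Hypothesis f_lsc : lower_semicontinuous f.
Implicit Types p q : epi f.

Lemma epi_mdistE p q : mdist p q =
  Num.sqrt (mdist (epi_pt p).1 (epi_pt q).1 ^+ 2
            + (epi_height p - epi_height q) ^+ 2).
Proof. by []. Qed.

Lemma epi_mdist_sqr p q : mdist p q ^+ 2 = mdist (epi_pt p).1 (epi_pt q).1 ^+ 2
            + (epi_height p - epi_height q) ^+ 2.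
Proof. by rewrite epi_mdistE sqr_sqrtr// addr_ge0 ?sqr_ge0. Qed.

Lemma mdist_le_epi p q : mdist (epi_pt p).1 (epi_pt q).1 <= mdist p q.
Proof.
rewrite -ler_sqr ?nnegrE ?mdist_ge0// epi_mdist_sqr lerDl; exact: sqr_ge0.
Qed.

Lemma height_le_epi p q : `|epi_height p - epi_height q| <= mdist p q.
Proof.
rewrite -ler_sqr ?nnegrE ?mdist_ge0// epi_mdist_sqr real_normK ?num_real//.
rewrite lerDr; exact: sqr_ge0.
Qed.

Lemma epi_mdist_leD p q :
  mdist p q <= mdist (epi_pt p).1 (epi_pt q).1 + `|epi_height p - epi_height q|.
Proof.
rewrite -ler_sqr ?nnegrE ?mdist_ge0 ?addr_ge0 ?mdist_ge0//.
rewrite epi_mdist_sqr [leRHS]sqrrD real_normK ?num_real//.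
by rewrite -addrA lerD2l lerDr mulrn_wge0// mulr_ge0// mdist_ge0.
Qed.

Lemma epi_height_continuous : continuous (@epi_height R X f).
Proof. exact/nonexpansive_real_continuous/height_le_epi. Qed.

Lemma epi_pt1_continuous : continuous (fun p : epi f => (epi_pt p).1).
Proof. exact/nonexpansive_continuous/mdist_le_epi. Qed.

Lemma cauchy_seq_cvg (Z : completeMetricType R) (v : nat -> Z) :
  (forall e, 0 < e -> exists n, forall k, (n <= k)%N -> mdist (v n) (v k) < e) ->
  exists l : Z, v n @[n --> \oo] --> l.
Proof.
move=> cv; suff /cauchy_cvgP/cvg_ex : cauchy (v n @[n --> \oo]) by [].
apply: cauchy_exP => e e0; have [n hn] := cv _ e0; exists (v n).
by exists n => // k /= nk; apply/ball_mdistP/hn.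
Qed.

(** Both components converge, and the limit stays in the epigraph by lower semicontinuity: if
    [r < a < f x], then [f > a] near [x], although the heights bound [f] from above and tend to
    [r]. *)
Lemma epi_complete (v : nat -> epi f) :
  (forall e, 0 < e -> exists n, forall k, (n <= k)%N -> mdist (v n) (v k) < e) ->
  exists l : epi f, v n @[n --> \oo] --> l.
Proof.
move=> cv.
have [x vx] : exists x : X, (epi_pt (v n)).1 @[n --> \oo] --> x.
  apply: cauchy_seq_cvg => e /cv[n hn]; exists n => k /hn.
  exact/le_lt_trans/mdist_le_epi.
have [r vr] : exists r : R, epi_height (v n) @[n --> \oo] --> r.
  suff /cauchy_cvgP/cvg_ex : cauchy (epi_height (v n) @[n --> \oo]) by [].
  apply: cauchy_exP => e /cv[n hn]; exists (epi_height (v n)).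
  exists n => // k /= /hn; exact/le_lt_trans/height_le_epi.
have fxr : (f (x, r).1 <= (x, r).2%:E)%E.
  rewrite leNgt /=; apply/negP => rfx.
  have [a /andP[ra afx]] : exists a, (r < a) && (a%:E < f x)%E.
    move: rfx; case: (f x) => [y|_|//].
      by rewrite lte_fin => ry; exists ((r + y) / 2); rewrite lte_fin midf_lt// midf_lt.
    by exists (r + 1); rewrite ltry ltrDl ltr01.
  have [V Vx Va] := f_lsc _ _ afx.
  have /cvgrPdist_lt/(_ (a - r)) := vr; rewrite subr_gt0 => /(_ ra) h.
  suff : \forall n \near \oo, False by move=> /filter_ex[].
  near=> n; have /= : `|r - epi_height (v n)| < a - r by near: n.
    have /Va : V (epi_pt (v n)).1 by near: n; exact: vx.
    move=> /lt_le_trans/(_ (epi_ptP (v n))); rewrite lte_fin ltr_norml.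
    by rewrite /epi_height; lra.
exists (Epi fxr); apply/metricType_numDomainType.cvgrPdist_lt => e e0.
have e20 : 0 < e / 2 by rewrite divr_gt0.
have /metricType_numDomainType.cvgrPdist_lt/(_ _ e20) h1 := vx.
have /cvgrPdist_lt/(_ _ e20) h2 := vr.
near=> n; apply: le_lt_trans (epi_mdist_leD _ _) _.
by rewrite [ltRHS]splitr ltrD//=; near: n.
Unshelve. all: by end_near. Qed.

End epigraph.

(** * The order on paths in the epigraph *)

Section path_order.
Context {R : realType} {X : completeMetricType R} (f : X -> \bar R).
Hypothesis f_lsc : lower_semicontinuous f.
Context {T : topologicalType} (D S : set T) (al be : R).
Hypotheses (al0 : 0 <= al) (be0 : 0 < be) (D0 : D !=set0).
Implicit Types p q : T -> epi f.

Definition path_height p : R := sup [set epi_height (p tau) | tau in D].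

(** Continuity of the lower path is part of the relation, so [path_le p p] holds exactly for paths
    continuous on [D]. The bound with [be] yields convergence in [epi f]; the one with [al] allows a
    sharper constant for the displacement in [X]. *)
Definition path_le q p := [/\ {within D, continuous q},
  forall tau, S tau -> q tau = p tau &
  forall tau, D tau -> [/\ epi_height (q tau) <= epi_height (p tau),
    mdist (q tau) (p tau) <= be * (path_height p - path_height q) &
    mdist (epi_pt (q tau)).1 (epi_pt (p tau)).1
      <= al * (path_height p - path_height q)]].

Lemma path_le_refl q p : path_le q p -> path_le q q.
Proof. by case=> cq _ _; split => // tau _; rewrite !mdistxx subrr !mulr0. Qed.

Lemma path_le_trans q p r : path_le p q -> path_le q r -> path_le p r.
Proof.
move=> [cp pqS pqD] [_ qrS qrD]; split => //.
  by move=> tau St; rewrite pqS ?qrS.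
move=> tau Dt; have [h1 h2 h3] := pqD _ Dt; have [h4 h5 h6] := qrD _ Dt.
have := metric_triangle (p tau) (q tau) (r tau).
have := metric_triangle (epi_pt (p tau)).1 (epi_pt (q tau)).1 (epi_pt (r tau)).1.
by split; lra.
Qed.

Lemma path_le_height p q : path_le p q -> path_height p <= path_height q.
Proof.
move=> [_ _ pq]; have [tau /pq[_ h _]] := D0.
by rewrite -subr_ge0 -(pmulr_rge0 _ be0) (le_trans _ h)// mdist_ge0.
Qed.

(** The bound [m] makes [sup] a genuine supremum. *)
Lemma path_height_ge p m tau : (forall tau, D tau -> epi_height (p tau) <= m) ->
  D tau -> epi_height (p tau) <= path_height p.
Proof.
move=> pm Dt; apply: sup_upper_bound; last by exists tau.
by split; [exists (epi_height (p tau)), tau|exists m => _ [z /pm ? <-]].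
Qed.

Lemma path_height_le p m : (forall tau, D tau -> epi_height (p tau) <= m) ->
  path_height p <= m.
Proof.
move=> pm; apply: ge_sup => [|_ [z /pm ? <-]//].
by have [tau Dt] := D0; exists (epi_height (p tau)), tau.
Qed.

(** The path heights decrease and stay above [m], hence are Cauchy. The displacement bounds turn
    this into uniform convergence on [D], so the limit path is continuous and inherits all the
    bounds. *)
Lemma path_le_chain (m M : R) (u : nat -> T -> epi f) :
  path_le (u 0%N) (u 0%N) -> (forall n, path_le (u n.+1) (u n)) ->
  (forall n, m <= path_height (u n)) ->
  (forall tau, D tau -> epi_height (u 0%N tau) <= M) ->
  exists q, forall n, path_le q (u n).
Proof.
move=> u00 uS um uM.
have ule n k : (n <= k)%N -> path_le (u k) (u n).
  elim: k => [|k ih]; first by rewrite leqn0 => /eqP ->; exact: u00.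
  rewrite leq_eqVlt => /orP[/eqP ->|]; first exact: path_le_refl _ _ (uS k).
  by rewrite ltnS => /ih; apply: path_le_trans.
have uMn n tau : D tau -> epi_height (u n tau) <= M.
  by move=> Dt; have [_ _ /(_ _ Dt)[h _ _]] := ule 0%N n (leq0n n);
    rewrite (le_trans h)// uM.
have hc e : 0 < e -> exists n, forall k, (n <= k)%N ->
    path_height (u n) - path_height (u k) < e.
  move=> e0; have hi : has_inf (range (fun n => path_height (u n))).
    by split; [exists (path_height (u 0%N)), 0%N|exists m => _ [n _ <-]].
  have [_ [n _ <-] hn] := inf_adherent e0 hi; exists n => k nk.
  rewrite ltrBlDr addrC; apply: lt_le_trans hn _; rewrite lerD2r.
  by apply: ge_inf; [exact: hi.2|exists k].
have [q0 hq0] : exists q, forall tau, D tau -> u n tau @[n --> \oo] --> q tau.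
  suff /choice[q hq] : forall tau, exists l : epi f,
      D tau -> u n tau @[n --> \oo] --> l.
    by exists q.
  move=> tau; have [Dt|nDt] := pselect (D tau); last by exists (u 0%N tau).
  have [|l hl] := @epi_complete _ _ f f_lsc (fun n => u n tau); last by exists l.
  move=> e e0; have [|n hn] := hc (e / be); first by rewrite divr_gt0.
  exists n => k nk; have [_ _ /(_ _ Dt)[_ h _]] := ule _ _ nk.
  rewrite metric_sym (le_lt_trans h)// mulrC -ltr_pdivlMr//; exact: hn.
(* [S] is not assumed to lie in [D], so the common value on [S] is imposed instead of being obtained
   as a limit. *)
pose q tau := if pselect (S tau) is left _ then u 0%N tau else q0 tau.
have hq tau : D tau -> u n tau @[n --> \oo] --> q tau.
  move=> Dt; rewrite /q; case: pselect => St; last exact: hq0.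
  apply: (@cvg_trans _ (u 0%N tau @[n --> \oo])); last exact: cvg_cst.
  apply: near_eq_cvg; near=> n.
  by have [_ h _] := ule 0%N n (leq0n n); rewrite h.
have hqe tau e n : D tau -> 0 < e ->
    exists2 k, (n <= k)%N & mdist (q tau) (u k tau) < e.
  move=> Dt e0; have /metricType_numDomainType.cvgrPdist_lt/(_ _ e0) h := hq _ Dt.
  have [k [h1 h2]] := filter_ex (filterI h (nbhs_infty_ge n)).
  by exists k.
have qh n tau : D tau -> epi_height (q tau) <= epi_height (u n tau).
  move=> Dt; apply/ler_addgt0Pr => e e0; have [k nk kq] := hqe _ _ n Dt e0.
  have [_ _ /(_ _ Dt)[h _ _]] := ule _ _ nk.
  have := le_lt_trans (height_le_epi _ _ _) kq; rewrite ltr_norml; lra.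
have qu n : path_height q <= path_height (u n).
  apply: path_height_le => tau Dt; rewrite (le_trans (qh n _ Dt))//.
  by apply: path_height_ge Dt => z; exact: uMn.
have qd n tau : D tau ->
    mdist (q tau) (u n tau) <= be * (path_height (u n) - path_height q).
  move=> Dt; apply/ler_addgt0Pr => e e0; have [k nk kq] := hqe _ _ n Dt e0.
  have [_ _ /(_ _ Dt)[_ h _]] := ule _ _ nk.
  have := metric_triangle (q tau) (u k tau) (u n tau).
  have : be * path_height q <= be * path_height (u k) by rewrite ler_pM2l.
  lra.
have qa n tau : D tau ->
    mdist (epi_pt (q tau)).1 (epi_pt (u n tau)).1
      <= al * (path_height (u n) - path_height q).
  move=> Dt; apply/ler_addgt0Pr => e e0; have [k nk kq] := hqe _ _ n Dt e0.
  have [_ _ /(_ _ Dt)[_ _ h]] := ule _ _ nk.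
  have := metric_triangle (epi_pt (q tau)).1 (epi_pt (u k tau)).1
    (epi_pt (u n tau)).1.
  have := le_lt_trans (mdist_le_epi _ _ _) kq.
  have : al * path_height q <= al * path_height (u k) by rewrite ler_wpM2l.
  lra.
have cq : {within D, continuous q}.
  apply/within_continuous_mdistP => tau Dt e e0.
  have e3 : 0 < e / 3 by rewrite divr_gt0.
  have [|n hn] := hc (e / 3 / be); first by rewrite divr_gt0.
  (* The index [n] does not depend on [z]: this is the uniformity behind the three-term estimate. *)
  have hqn z : D z -> mdist (q z) (u n z) <= e / 3.
    move=> Dz; apply/ler_addgt0Pr => d d0; have [k nk kq] := hqe _ _ n Dz d0.
    have [_ _ /(_ _ Dz)[_ h _]] := ule _ _ nk.
    have := metric_triangle (q z) (u k z) (u n z).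
    have := hn _ nk; rewrite ltr_pdivlMr// mulrC => h'; lra.
  have [/within_continuous_mdistP/(_ _ Dt _ e3) cu _ _] := ule _ _ (leqnn n).
  apply: filterS cu => z hz Dz.
  have := metric_triangle (q tau) (u n tau) (q z).
  have := metric_triangle (u n tau) (u n z) (q z).
  have := hqn _ Dt; have := hqn _ Dz; rewrite (metric_sym (q z)).
  have := hz Dz; lra.
exists q => n; split => //.
- move=> tau St; rewrite /q; case: pselect => //= _.
  by have [_ h _] := ule _ _ (leq0n n); rewrite h.
- by move=> tau Dt; split; [exact: qh|exact: qd|exact: qa].
Unshelve. all: by end_near. Qed.

End path_order.

(** * Minimal paths and highest points of small slope *)

Section minimax.
Context {R : realType} {X : completeMetricType R} (f : X -> \bar R).
Hypothesis f_lsc : lower_semicontinuous f.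
Context {T : topologicalType} (D S : set T) (s al : R).
Hypotheses (s0 : 0 < s) (al0 : 0 <= al) (al_s : 1 - s ^+ 2 <= (al * s) ^+ 2).
Hypotheses (cD : compact D) (D0 : D !=set0).
Implicit Types p q : T -> epi f.

Local Notation hle := (path_le f D S al s^-1).
Local Notation Phi := (path_height f D).

(** The highest points of the image form a compact set [C], so a single deformation moves all of
    them down while leaving the image of [S] fixed. *)
Lemma path_improve p (b M : R) : {within D, continuous p} ->
  (forall tau, D tau -> epi_height (p tau) <= M) ->
  (forall tau, S tau -> epi_height (p tau) <= b) -> b < Phi p ->
  (forall tau, D tau -> epi_height (p tau) = Phi p ->
     (s%:E < weak_slope (@epi_height R X f) (p tau))%E) ->
  exists2 q, hle q p & Phi q < Phi p.
Proof.
move=> cp pM pb bp ps.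
have hp tau : D tau -> epi_height (p tau) <= Phi p.
  by move=> Dt; apply: path_height_ge Dt => z; exact: pM.
have cpD : compact (p @` D) by apply: continuous_compact.
pose C := p @` D `&` @epi_height R X f @^-1` [set Phi p].
have cC : compact C.
  apply: compact_closedI => //; apply: closed_comp; last exact: closed_eq.
  by move=> y _; exact: epi_height_continuous.
have e0 : 0 < Phi p - b by rewrite subr_gt0.
have Cs y : C y -> (s%:E < weak_slope (@epi_height R X f) y)%E.
  by move=> [[tau Dt <-] /= ht]; exact: ps.
(* The height is 1-Lipschitz and at most [b] on the image of [S], so a deformation supported within
   [Phi p - b] of [C] does not move that image. *)
have [W [t0 t00 [oW CW Wt]]] := deformation_compact _ _ _ _ cC e0 Cs.
(* The part of the image outside [W] is compact and misses the top level, hence lies below it by a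
   gap [k]; if it is empty, any positive [k] serves. *)
have [k k0 hk] : exists2 k, 0 < k & forall tau, D tau -> ~ W (p tau) ->
    epi_height (p tau) <= Phi p - k.
  have [E0|/set0P E0] := eqVneq (p @` D `\` W) set0.
    exists 1 => // tau Dt Wt'; suff : set0 (p tau) by [].
    by rewrite -E0; split => //; exists tau.
  have [||y] := @compact_EVT_max _ R (@epi_height R X f) _ E0.
  - by apply: compact_closedI => //; exact: open_closedC.
  - by apply: continuous_subspaceT; exact: epi_height_continuous.
  rewrite inE => -[[tau Dt <-] nW] hy.
  exists (Phi p - epi_height (p tau)).
    rewrite subr_gt0 lt_neqAle hp// andbT; apply/eqP => e.
    by apply: nW; apply: CW; split => //; exists tau.
  move=> z Dz nWz; rewrite opprB addrCA subrr addr0; apply: hy.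
  by rewrite inE; split => //; exists z.
(* In [W] the heights drop by the full [s * t]; outside [W] they already lie [k >= s * t] below the
   top. Either way the maximum drops by [s * t]. *)
pose t := Num.min t0 (k / s).
have t_gt0 : 0 < t by rewrite lt_min t00 divr_gt0.
have tt0 : t <= t0 by rewrite ge_min lexx.
have tk : s * t <= k by rewrite mulrC -ler_pdivlMr// ge_min lexx orbT.
have [eta [Sg [ceta _ hS SW SV]]] := Wt t (ltW t_gt0) tt0.
pose q tau := eta (p tau).
have qpD tau : D tau -> epi_height (q tau) <= Phi p - s * t.
  move=> Dt; have [/andP[S0 S1] h1 h2] := hS (p tau).
  have [/SW S1'|nW] := pselect (W (p tau)).
    by rewrite (le_trans h2)// S1' mul1r lerD2r hp.
  have := hk _ Dt nW; have : 0 <= s * (Sg (p tau) * t).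
    by rewrite !mulr_ge0// ltW.
  by rewrite /q; lra.
have qp : Phi q <= Phi p - s * t by exact: path_height_le.
have st0 : 0 < s * t by rewrite mulr_gt0.
exists q; last by rewrite (le_lt_trans qp)// ltrBlDr ltrDl.
split.
- apply/subspace_continuousP => tau Dt.
  move/subspace_continuousP : cp => /(_ _ Dt) cp.
  exact: (@cvg_comp _ _ _ _ _ _ (nbhs (p tau))) cp (ceta (p tau)).
- move=> tau St; have [/andP[S0 S1] h1 h2] := hS (p tau).
  apply: mdist_positivity; apply/le_anti; rewrite mdist_ge0 andbT.
  rewrite (le_trans h1)// leNgt pmulr_lgt0//; apply/negP => /SV[y [_ hy]].
  move=> /ball_mdistP; have := height_le_epi _ y (p tau); rewrite hy.
  have := pb _ St; rewrite ler_norml => h3 /andP[_ h4] h5; lra.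
- move=> tau Dt; have [/andP[S0 S1] h1 h2] := hS (p tau).
  have St0 : 0 <= Sg (p tau) * t by rewrite mulr_ge0// ltW.
  have Stt : Sg (p tau) * t <= t by rewrite ler_piMl// ltW.
  (* The time spent at each point is paid for by the drop of the maximum, since [Sg <= 1]. *)
  have sSt : s * (Sg (p tau) * t) <= Phi p - Phi q.
    apply: (@le_trans _ _ (s * t)); first by rewrite ler_pM2l.
    by rewrite lerBrDl -lerBrDr.
  split.
  + by rewrite (le_trans h2)// gerBl mulr_ge0// ltW.
  + by rewrite (le_trans h1)// ler_pdivlMl.
  (* In epi f, a move of length at most r that drops by at least s r displaces the
     X-coordinate by at most sqrt (1 - s^2) r. *)
  + apply: (@le_trans _ _ (al * s * (Sg (p tau) * t))); last first.
      by rewrite -mulrA ler_wpM2l.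
    have als0 : 0 <= al * s * (Sg (p tau) * t).
      by apply: mulr_ge0 => //; apply: mulr_ge0 => //; exact: ltW.
    rewrite -ler_sqr ?nnegrE ?mdist_ge0//.
    have e1 := epi_mdist_sqr _ (q tau) (p tau).
    have e2 : mdist (q tau) (p tau) ^+ 2 <= (Sg (p tau) * t) ^+ 2.
      by rewrite ler_sqr ?nnegrE ?mdist_ge0.
    have e3 : (s * (Sg (p tau) * t)) ^+ 2
        <= (epi_height (q tau) - epi_height (p tau)) ^+ 2.
      rewrite -[leRHS]sqrrN ler_sqr ?nnegrE ?opprB ?subr_ge0; rewrite /q; last 2 first.
        by rewrite mulr_ge0// ltW.
        by rewrite (le_trans h2)// gerBl mulr_ge0// ltW.
      by lra.
    (* Here [al_s] enters: it bounds [sqrt (1 - s^2)] by [al * s]. *)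
    have e4 : (1 - s ^+ 2) * (Sg (p tau) * t) ^+ 2
        <= (al * s) ^+ 2 * (Sg (p tau) * t) ^+ 2.
      by rewrite ler_wpM2r// sqr_ge0.
    rewrite exprMn; apply: le_trans e4.
    move: e3; rewrite exprMn mulrBl mul1r; lra.
Qed.

(** A minimal path below [p0] exists by the ordering principle. Its sphere values are at most
    [b < m], so if all its highest points had slope above [s], [path_improve] would contradict
    minimality. *)
Lemma minimax_weak_slope p0 (b m M : R) : {within D, continuous p0} ->
  (forall tau, D tau -> epi_height (p0 tau) <= M) ->
  (forall tau, S tau -> epi_height (p0 tau) <= b) -> b < m ->
  (forall q, hle q p0 -> m <= Phi q) ->
  exists p tau, [/\ hle p p0, D tau, epi_height (p tau) = Phi p &
    (weak_slope (@epi_height R X f) (p tau) <= s%:E)%E].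
Proof.
move=> cp0 p0M p0b bm le_m.
have si0 : 0 < s^-1 by rewrite invr_gt0.
have le00 : hle p0 p0.
  by split => // tau _; rewrite !mdistxx subrr !mulr0.
have [||||p pp0 pmin] := exists_minimal_below hle Phi _ _ _ p0 m le00 le_m.
- exact: path_le_refl.
- by move=> q p r; apply: path_le_trans.
- exact: path_le_height.
- move=> u u0 uS.
  have up0 n : hle (u n) p0.
    by elim: n => [|n ih]; [rewrite u0|apply: path_le_trans (uS n) ih].
  apply: (@path_le_chain _ _ f f_lsc _ D S al s^-1 al0 si0 D0 m M u) => //.
  + by rewrite u0.
  + by move=> n; exact: le_m.
  + by move=> tau Dt; rewrite u0; exact: p0M.
have [cp pS pD] := pp0.
have [//|noslope] := pselect (exists p tau, [/\ hle p p0, D tau,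
  epi_height (p tau) = Phi p &
  (weak_slope (@epi_height R X f) (p tau) <= s%:E)%E]).
have [|||tau Dt ht|q qp] := path_improve p b M cp.
- by move=> tau Dt; have [h _ _] := pD _ Dt; rewrite (le_trans h)// p0M.
- by move=> tau St; rewrite pS// p0b.
- by rewrite (lt_le_trans bm)// le_m.
- by rewrite ltNge; apply/negP => h; apply: noslope; exists p, tau.
by rewrite ltNge pmin.
Qed.

End minimax.

(** * The Euclidean disk and a radial retraction *)

Section disk.
Context {R : realType} {N : nat}.
Implicit Types x : 'rV[R]_N.

Lemma enormZ (k : R) x : 0 <= k -> enorm (k *: x) = k * enorm x.
Proof.
move=> k0; rewrite /enorm.
under eq_bigr do rewrite mxE exprMn.
by rewrite -mulr_sumr sqrtrM ?sqr_ge0// sqrtr_sqr ger0_norm.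
Qed.

Lemma coord_le_enorm x i : `|x 0 i| <= enorm x.
Proof.
rewrite -sqrtr_sqr ler_wsqrtr// (bigD1 i)//= lerDl.
by apply: sumr_ge0 => j _; exact: sqr_ge0.
Qed.

Lemma enorm_continuous : continuous (@enorm R N).
Proof.
have cs : continuous (fun x : 'rV[R]_N => \sum_i x 0 i ^+ 2 : R).
  apply: continuous_big => [|i _ x]; first exact: add_continuous.
  by apply: (@continuousM R _ (fun z : 'rV[R]_N => z 0 i)); exact: coord_continuous.
move=> x; apply: (@continuous_comp 'rV[R]_N R R _ Num.sqrt); first exact: cs.
exact: sqrt_continuous.
Qed.

Lemma unit_disk_compact : compact (unit_disk R N).
Proof.
apply: bounded_closed_compact.
  exists 1; split => // M M1 x /= x1; apply: le_trans (ltW M1).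
  rewrite /Num.norm/= mx_normrE; apply/bigmax_leP; split => //= -[i j] _ /=.
  by rewrite (ord1 i) (le_trans (coord_le_enorm _ _)).
apply: (@closed_comp _ _ (@enorm R N) [set r | r <= 1]); last exact: closed_le.
by move=> x _; exact: enorm_continuous.
Qed.

(* Maps the half disk onto the disk and the collar onto the sphere: on the collar a
   lift of gamma \o disk_retract can lower its height continuously, which is
   impossible along gamma itself because f \o gamma is only lower semicontinuous. *)
Definition disk_retract x : 'rV[R]_N := (2 / Num.max 1 (2 * enorm x)) *: x.

Lemma enorm_disk_retract x :
  enorm (disk_retract x) = 2 * enorm x / Num.max 1 (2 * enorm x).
Proof.
by rewrite enormZ ?divr_ge0// ?le_max ?ler01//; ring.
Qed.

Lemma disk_retract_in x : unit_disk R N (disk_retract x).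
Proof.
rewrite /unit_disk/= enorm_disk_retract ler_pdivrMr ?lt_max ?ltr01// mul1r.
by rewrite le_max lexx orbT.
Qed.

Lemma disk_retract_sphere x : 2^-1 <= enorm x -> unit_sphere R N (disk_retract x).
Proof.
move=> h; have h' : 1 <= 2 * enorm x by rewrite -ler_pdivrMl// mulr1.
rewrite /unit_sphere/= enorm_disk_retract max_r// divff// gt_eqF//.
by rewrite (lt_le_trans _ h').
Qed.

Lemma disk_retract_id x : unit_sphere R N x -> disk_retract x = x.
Proof.
rewrite /unit_sphere/= /disk_retract => ->.
by rewrite mulr1 max_r ?ler1n// divff ?scale1r// pnatr_eq0.
Qed.

Lemma disk_retract_continuous : continuous disk_retract.
Proof.
move=> x; apply: (@continuousZ R _ _ (fun y => 2 / Num.max 1 (2 * enorm y)) id);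
  last exact: cvg_id.
apply: (@continuousM R _ (fun=> 2)); first exact: cst_continuous.
apply: (@continuousV R _ (fun y => Num.max 1 (2 * enorm y))).
  by rewrite gt_eqF// lt_max ltr01.
apply: (@continuous_max R _ (fun=> 1) (fun y => 2 * enorm y));
  first exact: cst_continuous.
apply: (@continuousM R _ (fun=> 2)); first exact: cst_continuous.
exact: enorm_continuous.
Qed.

End disk.

(** * Distance to a nonempty set *)

Section infimal_distance.
Context {R : realType} {Y : metricType R} (A : set Y).
Hypothesis A0 : A !=set0.

(** A real-valued counterpart of [dist_to], fit for building continuous cut-offs. *)
Definition inf_mdist y : R := inf [set mdist y v | v in A].

Let has_infA y : has_inf [set mdist y v | v in A].
Proof.
split; first by have [v Av] := A0; exists (mdist y v), v.
by exists 0 => _ [v _ <-]; exact: mdist_ge0.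
Qed.

Lemma inf_mdist_le y v : A v -> inf_mdist y <= mdist y v.
Proof. by move=> Av; apply: ge_inf; [exact: (has_infA y).2|exists v]. Qed.

Lemma inf_mdist_lt y (e : R) : inf_mdist y < e -> exists2 v, A v & mdist y v < e.
Proof.
rewrite -subr_gt0 => h; have [_ [v Av <-]] := inf_adherent h (has_infA y).
by rewrite -/(inf_mdist y) addrC subrK; exists v.
Qed.

Lemma inf_mdist_continuous : continuous inf_mdist.
Proof.
have lip y z : inf_mdist y - inf_mdist z <= mdist y z.
  rewrite lerBlDl -lerBlDr; apply: lb_le_inf; first exact: (has_infA z).1.
  move=> _ [v Av <-]; rewrite lerBlDr.
  rewrite (le_trans (inf_mdist_le _ _ Av))//.
  by rewrite addrC; exact: metric_triangle.
apply: nonexpansive_real_continuous => y z; rewrite ler_norml lip andbT.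
by have := lip z y; rewrite metric_sym; lra.
Qed.

End infimal_distance.

(** * From the slope of the height to the slope of [f] *)

Lemma lsc_weak_slope_le (R : realType) (X : metricType R) (f : X -> \bar R)
    (u : X) (fu : f u \is a fin_num) (sg : R) : 0 < sg ->
  (weak_slope (@epi_height R X f) (epi_graph fu)
     <= (sg / Num.sqrt (1 + sg ^+ 2))%:E)%E ->
  (lsc_weak_slope fu <= sg%:E)%E.
Proof.
move=> sg0; rewrite /lsc_weak_slope; set w := weak_slope _ _ => ws.
have q0 : 0 < 1 + sg ^+ 2 by rewrite addr_gt0// exprn_gt0.
have r0 : 0 < Num.sqrt (1 + sg ^+ 2) by rewrite sqrtr_gt0.
have r2 : Num.sqrt (1 + sg ^+ 2) ^+ 2 = 1 + sg ^+ 2 by rewrite sqr_sqrtr ?ltW.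
have s1 : sg / Num.sqrt (1 + sg ^+ 2) < 1.
  rewrite ltr_pdivrMr// mul1r -ltr_sqr ?nnegrE ?ltW// r2; lra.
have w1 : (w < 1)%E by rewrite (le_lt_trans ws)// lte_fin.
rewrite w1 lee_fin.
(* This case also absorbs the value [-oo], which [fine] sends to 0. *)
have [w0|w0] := leP (fine w) 0.
  apply: le_trans (ltW sg0).
  by rewrite mulr_le0_ge0// invr_ge0 sqrtr_ge0.
have wf : w = (fine w)%:E.
  by move: w0 w1; case: (w) => //= ; rewrite ltxx.
move: ws w0; rewrite wf lee_fin/= => ws w0.
(* The map [x / sqrt (1 - x^2)] inverts [sg / sqrt (1 + sg^2)]; squaring reduces both inequalities
   to this polynomial one. *)
have ws2 : fine w ^+ 2 * (1 + sg ^+ 2) <= sg ^+ 2.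
  rewrite -r2 -exprMn ler_sqr ?nnegrE ?mulr_ge0 ?(ltW w0) ?(ltW r0) ?(ltW sg0)//.
  by rewrite -ler_pdivlMr.
have w2 : 0 < 1 - fine w ^+ 2.
  rewrite subr_gt0; move: w1; rewrite wf lte_fin => w1.
  by rewrite expr_lt1// ltW.
rewrite ler_pdivrMr ?sqrtr_gt0//.
rewrite -ler_sqr ?nnegrE ?mulr_ge0 ?sqrtr_ge0 ?(ltW w0) ?(ltW sg0)//.
by rewrite exprMn sqr_sqrtr ?(ltW w2)//; lra.
Qed.

(** * Continuity of lifted paths *)

Lemma min_clamp_continuous (R : realType) (T : topologicalType) (g h : T -> R)
    (m b d : R) : continuous g -> continuous h ->
  continuous (fun x => m + b * Num.min (clamp (1 - g x / d)) (clamp (2 - 2 * h x))).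
Proof.
have clamp_comp (k : T -> R) : continuous k -> continuous (fun x => clamp (k x)).
  move=> ck x; apply: (@continuous_comp _ R R k clamp); first exact: ck.
  exact: clamp_continuous.
move=> cg ch x; apply: cvgD; first exact: cvg_cst.
apply: cvgM; first exact: cvg_cst.
apply: (@continuous_min R _ (fun x => clamp (1 - g x / d))
  (fun x => clamp (2 - 2 * h x))); apply: clamp_comp => y;
  (apply: cvgB; first exact: cvg_cst); apply: cvgM;
  by [exact: cvg_cst|exact: cg|exact: ch].
Qed.

Lemma continuous_comp_within (T U V : topologicalType) (D : set U)
    (r : T -> U) (g : U -> V) :
  continuous r -> (forall x, D (r x)) -> {within D, continuous g} ->
  continuous (g \o r).
Proof.
move=> cr rD /subspace_continuousP cg x B nB.
have h := cr x _ (cg _ (rD x) _ nB).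
by apply: (@filterS _ (nbhs x) _ _ _ _ h) => z /=; apply.
Qed.

Lemma epi_path_continuous (R : realType) (X : completeMetricType R)
    (f : X -> \bar R) (T : topologicalType) (D : set T) (p : T -> epi f) :
  {within D, continuous (fun tau => (epi_pt (p tau)).1)} ->
  {within D, continuous (fun tau => epi_height (p tau))} ->
  {within D, continuous p}.
Proof.
move=> /within_continuous_mdistP c1 /subspace_continuousP c2.
apply/within_continuous_mdistP => x Dx e e0.
have e20 : 0 < e / 2 by rewrite divr_gt0.
have h1 := c1 x Dx _ e20; have /cvgrPdist_lt/(_ _ e20) h2 := c2 x Dx.
apply: filterS2 h1 h2 => z h1 h2 Dz.
apply: le_lt_trans (epi_mdist_leD _ _ _) _.
by rewrite [ltRHS]splitr ltrD//=; [exact: h1|exact: h2].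
Qed.

(** * An almost critical point near a given competitor *)

Local Open Scope ereal_scope.

Theorem theorem3p8 (R : realType) (X : completeMetricType R) (f : X -> \bar R)
    (f_gtNy : forall x, -oo < f x)
    (f_lsc : lower_semicontinuous f)
    (f_slope : forall p : epi f, f (epi_pt p).1 < (epi_pt p).2%:E ->
       weak_slope (@epi_height R X f) p = 1)
    (N : nat) (Gamma0 : set ('rV[R]_N -> X))
    (Gamma0_cont : forall gamma0, Gamma0 gamma0 ->
       {within unit_sphere R N, continuous gamma0})
    (c a : \bar R)
    (cE : c = ereal_inf [set sup_on f (unit_disk R N) gamma
                        | gamma in disk_extensions Gamma0])
    (aE : a = ereal_sup [set sup_on f (unit_sphere R N) gamma0
                        | gamma0 in Gamma0])
    (c_lty : c < +oo) (lt_ac : a < c) :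
  forall eps : R, (0 < eps)%R -> eps%:E < (c - a) / 2%:E ->
  forall delta : R, (0 < delta)%R ->
  forall gamma, disk_extensions Gamma0 gamma ->
    sup_on f (unit_disk R N) gamma <= c + eps%:E ->
  exists (u : X) (fu : f u \is a fin_num),
    [/\ c - (2 * eps)%:E <= f u <= c + (2 * eps)%:E,
        dist_to u (gamma @` unit_disk R N `&`
          f @^-1` `[c - (3 * eps)%:E, c + (3 * eps)%:E]) <= (3 * delta)%:E
      & lsc_weak_slope fu <= (3 * eps / delta)%:E].
Proof.
move=> eps eps0 eps_ca delta del0 gamma [cgamma [gamma0 G0 gg0]] gsup.
have [cr crE] : exists cr, c = cr%:E.
  by case: (c) c_lty lt_ac => [r _ _|//|_]; [exists r|rewrite ltNge leNye].
(* The value [a = -oo] is possible: for [N = 0] the sphere is empty. *)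
have a_le : a <= (cr - 2 * eps)%:E.
  move: eps_ca lt_ac; rewrite crE; case: (a) => [r| |]; last by rewrite leNye.
    rewrite -EFinB inver pnatr_eq0/= -EFinM !lte_fin lee_fin ltr_pdivlMr//; lra.
  by move=> _; rewrite ltNge leey.
have c_le g : disk_extensions Gamma0 g -> cr%:E <= sup_on f (unit_disk R N) g.
  by move=> Gg; rewrite -crE cE; apply: ereal_inf_lbound; exists g.
have fD tau : unit_disk R N tau -> f (gamma tau) <= (cr + eps)%:E.
  move=> Dt; rewrite EFinD -crE; apply: le_trans gsup.
  by apply: ereal_sup_ubound; exists tau.
have fS tau : unit_sphere R N tau -> f (gamma tau) <= (cr - 2 * eps)%:E.
  move=> St; apply: le_trans a_le; rewrite gg0// aE.
  apply: (@le_trans _ _ (sup_on f (unit_sphere R N) gamma0)).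
    by apply: ereal_sup_ubound; exists tau.
  by apply: ereal_sup_ubound; exists gamma0.
pose A := gamma @` unit_disk R N `&` [set v | (cr - 2 * eps)%:E < f v].
have A0 : A !=set0.
  (* Otherwise [gamma] would be a competitor with supremum at most [c - 2 eps]. *)
  apply/set0P/eqP => A0.
  have : cr%:E <= (cr - 2 * eps)%:E.
    apply: le_trans (c_le gamma _) _; first by split => //; exists gamma0.
    apply: ge_ereal_sup => _ [tau Dt <-]; rewrite leNgt; apply/negP => h.
    by suff : set0 (gamma tau) by []; rewrite -A0; split => //; exists tau.
  by rewrite lee_fin; lra.
(* [k] is 1 over [A] when [enorm tau <= 1/2], and 0 on the sphere or at distance at least [delta]
   from [A]. *)
pose k tau : R := Num.min (clamp (1 - inf_mdist A (gamma (disk_retract tau)) / delta))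
  (clamp (2 - 2 * enorm tau)).
have k1 tau : (k tau <= 1)%R by rewrite ge_min clamp_le1.
have k0 tau : (0 <= k tau)%R by rewrite le_min !clamp_ge0.
pose xi tau : R := (cr - 2 * eps + 3 * eps * k tau)%R.
have xiP tau : f (gamma (disk_retract tau), xi tau).1
    <= (gamma (disk_retract tau), xi tau).2%:E.
  (* Where [f] exceeds [c - 2 eps], the point lies in [A] and [tau] is off the collar, which is sent
     to the sphere. There [k = 1] and the height is [c + eps]. *)
  have [h|h] := leP (f (gamma (disk_retract tau))) (cr - 2 * eps)%:E.
    by apply: le_trans h _; rewrite lee_fin/= lerDl !mulr_ge0// ltW.
  rewrite /xi; suff -> : k tau = 1%R.
    by rewrite (le_trans (fD _ (disk_retract_in _)))// lee_fin/=; lra.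
  have tau2 : (enorm tau < 2^-1)%R.
    by rewrite ltNge; apply/negP => /disk_retract_sphere/fS; rewrite leNgt h.
  have c2 : clamp (2 - 2 * enorm tau)%R = 1%R by apply: clamp1; lra.
  rewrite /k c2 clamp1 ?minxx// lerBrDr gerDl ler_pdivrMr// mul0r.
  rewrite -(mdistxx (gamma (disk_retract tau))).
  apply: inf_mdist_le => //; split => //; exists (disk_retract tau) => //.
  exact: disk_retract_in.
pose p0 tau : epi f := Epi (xiP tau).
have cgr : continuous (gamma \o disk_retract).
  apply: continuous_comp_within cgamma.
    exact: disk_retract_continuous.
  exact: disk_retract_in.
have cxi : continuous xi.
  have cg : continuous (inf_mdist A \o (gamma \o disk_retract)).
    move=> tau; apply: continuous_comp; first exact: cgr.
    exact: inf_mdist_continuous.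
  exact: (min_clamp_continuous _ _ _ _ (cr - 2 * eps)%R (3 * eps)%R delta
    cg enorm_continuous).
have cp0 : {within unit_disk R N, continuous p0}.
  by apply: epi_path_continuous; apply: continuous_subspaceT.
pose sg : R := (3 * eps / delta)%R.
have sg0 : (0 < sg)%R by rewrite divr_gt0// mulr_gt0.
(* The slope of the height that corresponds to slope [sg] of [f]. With [al = 1 / sg] both sides of
   [al_s] equal [1 / (1 + sg^2)]. *)
pose s : R := (sg / Num.sqrt (1 + sg ^+ 2))%R.
have q0 : (0 < 1 + sg ^+ 2)%R by rewrite addr_gt0// exprn_gt0.
have r0 : (0 < Num.sqrt (1 + sg ^+ 2))%R by rewrite sqrtr_gt0.
have s0 : (0 < s)%R by rewrite divr_gt0.
have s2 : (s ^+ 2 = sg ^+ 2 / (1 + sg ^+ 2))%R.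
  by rewrite expr_div_n sqr_sqrtr// ltW.
have al_s : (1 - s ^+ 2 <= (sg^-1 * s) ^+ 2)%R.
  rewrite [leRHS]exprMn s2 le_eqVlt; apply/orP; left; apply/eqP; field.
  by rewrite !gt_eqF.
have al0 : (0 <= sg^-1)%R by rewrite invr_ge0 ltW.
have D0 : unit_disk R N !=set0 by exists (disk_retract 0%R); exact: disk_retract_in.
have p0M tau : unit_disk R N tau -> (epi_height (p0 tau) <= cr + eps)%R.
  move=> _; rewrite /epi_height/= /xi.
  have : (eps * k tau <= eps)%R by rewrite ler_piMr// ltW.
  lra.
have p0S tau : unit_sphere R N tau -> (epi_height (p0 tau) <= cr - 2 * eps)%R.
  rewrite /unit_sphere/= /epi_height/= /xi /k => ->.
  by rewrite mulr1 subrr (clamp0 0%R)// min_r ?clamp_ge0// mulr0 addr0.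
pose Phi := path_height f (unit_disk R N).
pose le_path := path_le f (unit_disk R N) (unit_sphere R N) sg^-1 s^-1.
(* The [X]-component of [q] is itself a competitor, because [disk_retract] fixes the sphere, and [f]
   along it is bounded by the height. *)
have c_height q : le_path q p0 -> (cr <= Phi q)%R.
  move=> [cq qS qD].
  rewrite -lee_fin; apply: le_trans (c_le (fun tau => (epi_pt (q tau)).1) _) _.
    split.
      apply: (@within_continuous_comp _ _ _ _ q (fun y : epi f => (epi_pt y).1)) cq.
      by move=> y _; exact: epi_pt1_continuous.
    exists gamma0 => // tau St; rewrite qS// -gg0//=.
    by rewrite disk_retract_id.
  apply: ge_ereal_sup => _ [tau Dt <-].
  apply: le_trans (epi_ptP (q tau)) _; rewrite lee_fin.
  apply: (path_height_ge _ _ _ (cr + eps)%R) => // z Dz.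
  by have [h _ _] := qD _ Dz; rewrite (le_trans h)// p0M.
have [|p [tau [pp0 Dt ht ws]]] := minimax_weak_slope f f_lsc
  (unit_disk R N) (unit_sphere R N) s sg^-1 s0 al0 al_s unit_disk_compact D0 p0
  (cr - 2 * eps)%R cr (cr + eps)%R cp0 p0M p0S _ c_height.
  by rewrite ltrBlDr ltrDl mulr_gt0.
have cp : (cr <= epi_height (p tau))%R by rewrite ht; exact: c_height pp0.
have [_ _ /(_ _ Dt)[hpt _ dpt]] := pp0.
have Phi0 : (Phi p0 <= cr + eps)%R by exact: path_height_le.
have pP : (epi_height (p tau) <= Phi p0)%R.
  by rewrite ht; apply: path_le_height pp0; rewrite ?invr_gt0.
rewrite -ht -/Phi in dpt.
set u := (epi_pt (p tau)).1 in dpt.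
(* A point strictly above the graph has slope 1, whereas the slope here is at most [s < 1]. *)
have fu_eq : f u = (epi_height (p tau))%:E.
  apply/eqP; rewrite eq_le (epi_ptP (p tau))/= leNgt; apply/negP => /f_slope ws1.
  move: ws; rewrite ws1 lee_fin; apply/negP; rewrite -ltNge.
  rewrite ltr_pdivrMr// mul1r -ltr_sqr ?nnegrE ?(ltW sg0) ?(ltW r0)//.
  by rewrite sqr_sqrtr ?(ltW q0)//; lra.
have fu : f u \is a fin_num by rewrite fu_eq.
exists u, fu; split.
- rewrite fu_eq crE -EFinB -EFinD !lee_fin; lra.
(* Height at least [c] at [p0 tau] forces [k tau > 0], which yields a point [v] of [A] within
   [delta] of [gamma (disk_retract tau)]. *)
- have : (cr <= epi_height (p0 tau))%R by exact: le_trans cp hpt.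
  rewrite /epi_height/= /xi => hk.
  have : (0 < k tau)%R.
    rewrite lt_neqAle k0 andbT; apply/eqP => k00; move: hk; rewrite -k00; lra.
  rewrite lt_min => /andP[kpos _].
  have /inf_mdist_lt : (inf_mdist A (gamma (disk_retract tau)) < delta)%R.
    rewrite ltNge; apply/negP => h; move: kpos; rewrite clamp0 ?ltxx//.
    by rewrite subr_le0 ler_pdivlMr// mul1r.
  move=> /(_ A0)[v [gv fv] dv].
  apply: (@le_trans _ _ (mdist u v)%:E).
    apply: ereal_inf_lbound; exists v => //; split => //=.
    rewrite in_itv/= crE -EFinB -EFinD; move: gv fv => [z Dz <-] /= fv.
    rewrite (le_trans (fD _ Dz)) ?lee_fin ?andbT; last by lra.
    by apply: le_trans (ltW fv); rewrite lee_fin; lra.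
  have := metric_triangle u (gamma (disk_retract tau)) v.
  (* The height difference is at most [eps], and [eps / sg = delta / 3]. *)
  have : (sg^-1 * (Phi p0 - epi_height (p tau)) <= delta)%R.
    rewrite ler_pdivrMl// /sg.
    by rewrite mulrAC -mulrA divff ?gt_eqF// mulr1; lra.
  by rewrite lee_fin; move: dpt => /=; lra.
- apply: lsc_weak_slope_le => //; rewrite -/sg -/s.
  suff -> : epi_graph fu = p tau by [].
  apply: val_inj => /=; rewrite fu_eq/=.
  by rewrite /u /epi_height; case: (epi_pt (p tau)).
Qed.
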